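(* Let $p\in(0,1)$, let $(x_j)_{j\ge1}$ be independent and identically distributed $\mathrm{Bern}(p)$ random variables, put $x_0:=x_1$, and define $$X_0=0,\qquad X_j=\mathrm{xor}(x_j,x_{j-1})\,(1-X_{j-1}),\quad j\ge 1,$$ and $$M_j=(x_j,x_{j-1},X_{j-1})\in\{0,1\}^3,\qquad j\ge1.$$ Then $(M_j)_{j\ge1}$ is an irreducible, aperiodic Markov chain on the $8$-element state space $\{0,1\}^3$, and for every $n\ge1$, with $\mathbf x=(x_1,\ldots,x_n)$, $$\operatorname{HS}(\mathcal T_n^{\mathrm B}(\mathbf x))=\sum_{j=1}^n X_j=\sum_{j=1}^n f(M_j),$$ where $f(a,b,c)=\mathrm{xor}(a,b)(1-c)$.
   Context: A rooted binary tree is a finite nonempty rooted tree in which each node has at most one left child and at most one right child. The Horton--Strahler (HS) number of a node $v$ is: $0$ if $v$ has no children; the HS number of the child if $v$ has exactly one child; and $\max(\operatorname{HS}(v_\ell),\operatorname{HS}(v_r))+\mathbf 1_{\{\operatorname{HS}(v_\ell)=\operatorname{HS}(v_r)\}}$ if $v$ has children $v_\ell,v_r$. $\operatorname{HS}(\mathcal T)$ is the HS number of the root of $\mathcal T$. $\mathcal T_1\oplus\mathcal T_2$ is obtained by making the root of $\mathcal T_2$ the right child of the last node of the path from the root of $\mathcal T_1$ that always moves to the right child; $\mathcal T_1\ominus\mathcal T_2$ is obtained by making the root of $\mathcal T_2$ the left child of the last node of the path from the root of $\mathcal T_1$ that always moves to the left child. Simple butterfly trees: for a bitstring $\mathbf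 x=(x_1,\ldots,x_n)\in\{0,1\}^n$, the simple butterfly tree $\mathcal T_n^{\mathrm B}(\mathbf x)$, with $2^n$ nodes, is defined recursively: $\mathcal T_0^{\mathrm B}$ (empty string) is a single node, and with $\mathcal S=\mathcal T_{n-1}^{\mathrm B}(x_1,\ldots,x_{n-1})$, $\mathcal T_n^{\mathrm B}(\mathbf x)$ is $\mathcal S\oplus\mathcal S$ if $x_n=0$ and $\mathcal S\ominus\mathcal S$ if $x_n=1$ (two identical copies of $\mathcal S$). For bits $a,b\in\{0,1\}$, $\mathrm{xor}(a,b)=1$ if $a\ne b$ and $0$ otherwise. *)

(* Defs.v *)
From HB Require Import structures.
From mathcomp Require Import all_boot all_order all_algebra.
From mathcomp Require Import all_classical all_reals all_analysis.

Set Implicit Arguments.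
Unset Strict Implicit.
Unset Printing Implicit Defensive.

Import Order.TTheory GRing.Theory Num.Theory.

Local Open Scope classical_set_scope.
Local Open Scope ring_scope.

(* [Node l r]: the optional left and right subtrees hanging from a root; there
   is no empty tree. *)
Inductive btree : Type := Node of option btree & option btree.

Fixpoint HS (t : btree) : nat :=
  let: Node l r := t in
  match l, r with
  | None, None => 0%N
  | Some u, None | None, Some u => HS u
  | Some u, Some v => (maxn (HS u) (HS v) + (HS u == HS v))%N
  end.

(* The recursion follows the right (resp. left) spine of [t1] down to its last
   node, where [t2] is attached. *)
Fixpoint oplus (t1 t2 : btree) : btree :=
  let: Node l r := t1 in
  Node l (Some (if r is Some r' then oplus r' t2 else t2)).

Fixpoint ominus (t1 t2 : btree) : btree :=
  let: Node l r := t1 in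
  Node (Some (if l is Some l' then ominus l' t2 else t2)) r.

(* Bits are booleans (0 = false, 1 = true). The left fold makes the last bit of
   the string decide the outermost operation. *)
Definition butterfly (x : seq bool) : btree :=
  foldl (fun S b => if b then ominus S S else oplus S S) (Node None None) x.

(* [Xseq x j] is the bit X_j computed from the bits x 0, x 1, ...; on bits,
   xor is [(+)], 1 - c is [~~ c] and the product is [&&]. *)
Fixpoint Xseq (x : nat -> bool) (j : nat) : bool :=
  if j is i.+1 then (x i.+1 (+) x i) && ~~ Xseq x i else false.

(* [Mseq x j] is M_j for j >= 1; its value at j = 0 is meaningless. *)
Definition Mseq (x : nat -> bool) (j : nat) : bool * bool * bool :=
  (x j, x j.-1, Xseq x j.-1).

Definition f (m : bool * bool * bool) : bool :=
  let: (a, b, c) := m in (a (+) b) && ~~ c.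

Section Probability.
Context (d : measure_display) (T : measurableType d) (R : realType).
Variable P : probability T R.

Definition mutually_independent (d' : measure_display) (T' : measurableType d')
    (I : choiceType) (X : I -> {RV P >-> T'}) : Prop :=
  forall (J : seq I) (B : I -> set T'), uniq J -> (forall i, measurable (B i)) ->
    P (\bigcap_(i in [set` J]) (X i @^-1` B i)) =
    (\prod_(i <- J) P (X i @^-1` B i))%E.

Definition iid_bernoulli (p : R) (X : nat -> {RV P >-> bool}) : Prop :=
  mutually_independent X /\
  forall j (B : set bool), distribution P (X j) B = bernoulli_prob p B.

(* P(A | B), only meaningful when P B > 0. *)
Definition cond_prob (A B : set T) : R := fine (P (A `&` B)) / fine (P B).

Definition stochastic (S : finType) (Q : S -> S -> R) : Prop :=
  forall s, (forall t, 0 <= Q s t) /\ \sum_t Q s t = 1.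

(* [M] is a (time-homogeneous) Markov chain on the finite state space [S] with
   transition matrix [Q] and an arbitrary initial distribution. The first
   conjunct says that each [M n] is a random element of the discrete space
   [S]. *)
Definition markov_chain (S : finType) (M : nat -> T -> S) (Q : S -> S -> R) :
    Prop :=
  [/\ forall n s, measurable [set w | M n w = s],
      stochastic Q &
      forall n (s : nat -> S),
        let past := [set w | forall i, (i <= n)%N -> M i w = s i] in
        (0 < P past)%E ->
        cond_prob [set w | M n.+1 w = s n.+1] past = Q (s n) (s n.+1)].

End Probability.

Section TransitionMatrix.
Context (R : realType) (S : finType).
Implicit Type Q : S -> S -> R.

Fixpoint nstep Q (n : nat) (s t : S) : R :=
  if n is m.+1 then \sum_u Q s u * nstep Q m u t else (s == t)%:R.

Definition irreducible Q : Prop :=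
  forall s t, exists2 n, (0 < n)%N & 0 < nstep Q n s t.

(* [g] is the gcd of the set [A], also when [A] is infinite. *)
Definition is_gcd (A : set nat) (g : nat) : Prop :=
  (forall n, A n -> g %| n)%N /\
  (forall e, (forall n, A n -> e %| n)%N -> (e %| g)%N).

Definition aperiodic Q : Prop :=
  forall s, is_gcd [set n | (0 < n)%N /\ 0 < nstep Q n s s] 1%N.

End TransitionMatrix.

(* Main.v *)
(* Grafting a tree of Horton-Strahler number k = HS t at the bottom of the right
   spine of t raises the number to k + 1 exactly when some left subtree hanging
   from that spine has number k; mirror-symmetrically for the left spine. For
   butterfly trees these two events, together with the fact that such a subtree
   can only hang from the root, form a state that is updated by each new bit in
   the same way as (x_j, X_j), so the increments of HS are the X_j.
   For the chain, M_(j+1) is a function of M_j and the fresh bit x_(j+1), while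
   the past (M_1, ..., M_j) is a cylinder event in x_1, ..., x_j. Any state can
   be reached from any other in exactly 4 steps and in exactly 5 steps, which
   gives both irreducibility and aperiodicity. *)

Require Import Defs.
From HB Require Import structures.
From mathcomp Require Import all_boot all_order all_algebra.
From mathcomp Require Import zify.
From mathcomp Require Import all_classical all_reals all_analysis.

Set Implicit Arguments.
Unset Strict Implicit.
Unset Printing Implicit Defensive.

Import Order.TTheory GRing.Theory Num.Theory.

Local Open Scope classical_set_scope.
Local Open Scope ring_scope.

(** * Horton-Strahler numbers under grafting *)

Fixpoint mirror (t : btree) : btree :=
  let: Node l r := t in Node (omap mirror r) (omap mirror l).

Lemma mirrorK : involutive mirror.
Proof.
rewrite /involutive /cancel; fix IH 1 => -[l r] /=.
by congr Node; [case: l => [l|] | case: r => [r|]] => //=; rewrite IH.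
Qed.

Lemma HS_mirror t : HS (mirror t) = HS t.
Proof.
move: t; fix IH 1 => -[[l|] [r|]] //=; rewrite !IH //.
by rewrite maxnC eq_sym.
Qed.

(** Together with [HS_mirror], this reduces every fact about [ominus] to one about [oplus]. *)
Lemma mirror_ominus t u : mirror (ominus t u) = oplus (mirror t) (mirror u).
Proof.
move: t; fix IH 1 => -[[l|] r] //=.
by rewrite IH.
Qed.

(* Some left subtree hanging from the right spine of [t] has HS number [k]; the
   left spine is treated through [mirror]. *)
Fixpoint spine_hit (k : nat) (t : btree) : bool :=
  let: Node l r := t in
  (if l is Some l' then HS l' == k else false) ||
  (if r is Some r' then spine_hit k r' else false).

Definition subspine_hit (k : nat) (t : btree) : bool :=
  let: Node _ r := t in if r is Some r' then spine_hit k r' else false.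

Lemma spine_hit_le k t : spine_hit k t -> (k <= HS t)%N.
Proof.
move: t; fix IH 1 => -[[l|] [r|]] //=; last exact: IH.
  move=> H; apply: leq_trans (leq_addr _ _); rewrite leq_max.
  by case/orP: H => [/eqP->|/IH->]; rewrite ?leqnn ?orbT.
by case/orP => // /eqP ->.
Qed.

Lemma spine_hit_oplus k t u :
  spine_hit k (oplus t u) = spine_hit k t || spine_hit k u.
Proof.
move: t; fix IH 1 => -[l [r|]] /=.
  by rewrite IH orbA.
by rewrite orbF.
Qed.

(** The bound [k] is decoupled from [HS t] because subtrees lower on the spine may have smaller
    numbers. Going up from the graft, the number is [k] until a left subtree of number [k] raises it
    to k + 1; no later one raises it again, as all have number at most [k]. *)
Lemma HS_oplus k t u : (HS t <= k)%N -> HS u = k ->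
  HS (oplus t u) = (k + spine_hit k t)%N.
Proof.
move=> tk uk; move: t tk; fix IH 1 => -[[l|] [r|]] /=.
- move=> H; have : (maxn (HS l) (HS r) <= k)%N := leq_trans (leq_addr _ _) H.
  rewrite geq_max => /andP[lk rk]; rewrite IH //.
  case: (spine_hit k r) H => /= H; lia.
- rewrite uk => lk; lia.
- by move=> rk; rewrite IH.
- by rewrite uk addn0.
Qed.

(* The last two equations say that only the root of [t] can carry a hit. *)
Definition hit_state (a b : bool) (t : btree) : Prop :=
  [/\ spine_hit (HS t) t = a, spine_hit (HS t) (mirror t) = b,
      subspine_hit (HS t) t = false & subspine_hit (HS t) (mirror t) = false].

Lemma hit_state_mirror a b t : hit_state a b t -> hit_state b a (mirror t).
Proof. by case=> *; split; rewrite HS_mirror ?mirrorK. Qed.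

Lemma HS_oplus_hit a b t : hit_state a b t -> HS (oplus t t) = (HS t + a)%N.
Proof. by case=> <- _ _ _; exact: HS_oplus. Qed.

Lemma subspine_hitF k t : spine_hit k t = false -> subspine_hit k t = false.
Proof. by case: t => l [r|] //= /negbT/norP[_ /negbTE]. Qed.

Lemma HS_right l r : (HS r <= HS (Node l (Some r)))%N.
Proof. by case: l => [l|] //=; lia. Qed.

(* The right child of the root of [oplus t u]. *)
Definition right_graft (t u : btree) : btree :=
  if t is Node _ (Some r) then oplus r u else u.

Lemma spine_hit_mirror_oplus k t u : spine_hit k (mirror (oplus t u)) =
  (HS (right_graft t u) == k) || subspine_hit k (mirror t).
Proof. by case: t => [[l|] [r|]]; rewrite /= HS_mirror. Qed.

Lemma subspine_hit_mirror_oplus k t u :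
  subspine_hit k (mirror (oplus t u)) = subspine_hit k (mirror t).
Proof. by case: t => [[l|] [r|]]. Qed.

Lemma HS_right_graft k t u : (HS t <= k)%N -> HS u = k ->
  HS (right_graft t u) = (k + subspine_hit k t)%N.
Proof.
case: t => l [r|] /= tk uk; last by rewrite addn0.
exact/HS_oplus/uk/(leq_trans (HS_right l r)).
Qed.

(** If [a] holds, the new number exceeds that of everything hanging from the right spine; if not,
    neither copy has a hit there. On the left side, the new right subtree of the root still has
    number [HS t], so it is a hit exactly when the number did not rise. *)
Lemma hit_state_oplus a b t :
  hit_state a b t -> hit_state false (~~ a) (oplus t t).
Proof.
move=> h; have E := HS_oplus_hit h; case: h => ha hb hr hl.
have graftE := HS_right_graft (leqnn (HS t)) erefl.
have no_hit u : HS u = HS t -> spine_hit (HS t + 1) u = false.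
  by move=> tu; apply/negP => /spine_hit_le; rewrite tu; lia.
have hit0 : spine_hit (HS t + a) (oplus t t) = false.
  rewrite spine_hit_oplus orbb.
  by case: (a) ha => [_|]; [exact: no_hit | rewrite addn0].
have sub0 : subspine_hit (HS t + a) (mirror t) = false.
  case: (a); last by rewrite addn0.
  exact/subspine_hitF/no_hit/HS_mirror.
rewrite /hit_state E spine_hit_mirror_oplus subspine_hit_mirror_oplus sub0.
split=> //; last exact: subspine_hitF.
by rewrite graftE hr orbF; case: (a); lia.
Qed.

Lemma HS_ominus_hit a b t : hit_state a b t -> HS (ominus t t) = (HS t + b)%N.
Proof.
move/hit_state_mirror/HS_oplus_hit.
by rewrite -mirror_ominus !HS_mirror.
Qed.

Lemma hit_state_ominus a b t :
  hit_state a b t -> hit_state (~~ b) false (ominus t t).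
Proof.
move/hit_state_mirror/hit_state_oplus/hit_state_mirror.
by rewrite -mirror_ominus mirrorK.
Qed.

(** A hit lies on the spine opposite to the last operation, and only if that operation did not raise
    the number. Hence the next bit raises it exactly when it differs from the last one and X is
    0. *)
Lemma butterfly_hit_state (y : nat -> bool) n : y 0%N = y 1%N ->
  let t := butterfly [seq y j | j <- iota 1 n] in
  let X := Xseq y n in
  HS t = (\sum_(1 <= j < n.+1) Xseq y j)%N /\
  hit_state ((0 < n)%N && y n && ~~ X) ((0 < n)%N && ~~ y n && ~~ X) t.
Proof.
move=> y01; elim: n => [|n]; first by rewrite big_geq.
have -> : iota 1 n.+1 = iota 1 n ++ [:: n.+1].
  by rewrite -[in LHS](addn1 n) iotaD.
rewrite /butterfly map_cat foldl_cat /=.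
move: (foldl _ _ [seq y j | j <- iota 1 n]) => t [IH h].
rewrite big_nat_recr //= -IH.
case yn1: (y n.+1).
  rewrite (HS_ominus_hit h); have := hit_state_ominus h.
  (* A single node has no hits, which matches X_1 = 0, forced by [y01]. *)
  case: n {IH h} y01 yn1 => [y01 yn1|n _ yn1]; first by rewrite y01 yn1.
  by case: (y n.+1); case: (Xseq y n.+1).
rewrite (HS_oplus_hit h); have := hit_state_oplus h.
case: n {IH h} y01 yn1 => [y01 yn1|n _ yn1]; first by rewrite y01 yn1.
by case: (y n.+1); case: (Xseq y n.+1).
Qed.

(** * The transition matrix and its powers *)

Definition Mstep (y : bool) (s : bool * bool * bool) : bool * bool * bool :=
  (y, s.1.1, f s).

Lemma MseqS x n : Mseq x n.+2 = Mstep (x n.+2) (Mseq x n.+1).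
Proof. by []. Qed.

Section Transition.
Context (R : realType) (p : R).
Context (p_gt0 : 0 < p) (p_lt1 : p < 1).

Definition bern (b : bool) : R := if b then p else 1 - p.

Definition Mtrans (s t : bool * bool * bool) : R :=
  if t == Mstep t.1.1 s then bern t.1.1 else 0.

Lemma bern_gt0 b : 0 < bern b.
Proof. by case: b; rewrite //= subr_gt0. Qed.

Lemma Mtrans_ge0 s t : 0 <= Mtrans s t.
Proof. by rewrite /Mtrans; case: ifP => // _; exact/ltW/bern_gt0. Qed.

Lemma stochastic_Mtrans : stochastic Mtrans.
Proof.
move=> s; split=> [t|]; first exact: Mtrans_ge0.
rewrite -(pair_bigA _ (fun u c => Mtrans s (u, c))) /=.
rewrite -(pair_bigA _ (fun a b => \sum_c Mtrans s (a, b, c))) /= !big_bool.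
rewrite /Mtrans /Mstep /bern /=.
by case: s => [[[] []] []] /=; rewrite ?(addr0, add0r) subrKC.
Qed.

Lemma nstep_Mtrans_ge0 n s t : 0 <= nstep Mtrans n s t.
Proof.
elim: n s => [|n IH] s /=; first exact: ler0n.
by apply: sumr_ge0 => u _; rewrite mulr_ge0 ?Mtrans_ge0.
Qed.

(** The path driven by the bits [ys] has positive weight, and the other paths contribute nonnegative
    terms. *)
Lemma nstep_foldl_Mstep_gt0 ys s :
  0 < nstep Mtrans (size ys) s (foldl (fun s y => Mstep y s) s ys).
Proof.
elim: ys s => [|y ys IH] s /=; first by rewrite eqxx ltr01.
rewrite (bigD1 (Mstep y s)) //= ltr_wpDr //.
  by apply: sumr_ge0 => u _; rewrite mulr_ge0 ?Mtrans_ge0 ?nstep_Mtrans_ge0.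
by rewrite mulr_gt0 ?IH // /Mtrans eqxx bern_gt0.
Qed.

(* The state (a, b, c) is entered by feeding the bits xor(b, c) twice, which
   forces X = 0, then b, which sets X to c, and finally a. *)
Lemma nstep4_gt0 s t : 0 < nstep Mtrans 4 s t.
Proof.
case: t => [[a b] c].
rewrite (_ : (a, b, c) =
  foldl (fun s y => Mstep y s) s [:: b (+) c; b (+) c; b; a]).
  exact: (nstep_foldl_Mstep_gt0 [:: _; _; _; _]).
by move: a b c s => [] [] [] [[[] []] []].
Qed.

Lemma nstep5_gt0 s t : 0 < nstep Mtrans 5 s t.
Proof.
case: t => [[a b] c].
(* The leading bit is arbitrary padding: the remaining four lead to the target from any state. *)
rewrite (_ : (a, b, c) =
  foldl (fun s y => Mstep y s) s [:: a; b (+) c; b (+) c; b; a]).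
  exact: (nstep_foldl_Mstep_gt0 [:: _; _; _; _; _]).
by move: a b c s => [] [] [] [[[] []] []].
Qed.

Lemma irreducible_Mtrans : irreducible Mtrans.
Proof. by move=> s t; exists 4; last exact: nstep4_gt0. Qed.

Lemma aperiodic_Mtrans : aperiodic Mtrans.
Proof.
move=> s; split=> [n _|e he]; first exact: dvd1n.
have e4 : (e %| 4)%N by apply: he; split=> //; exact: nstep4_gt0.
by rewrite -(dvdn_addr 1 e4); apply: he; split=> //; exact: nstep5_gt0.
Qed.

End Transition.

(** * Law of the bits and the Markov property *)

Section Bits.
Context (d : measure_display) (T : measurableType d) (R : realType).
Context (P : probability T R) (x : nat -> {RV P >-> bool}).

Lemma measurable_addb (g h : T -> bool) :
  measurable_fun setT g -> measurable_fun setT h ->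
  measurable_fun setT (fun w => g w (+) h w).
Proof.
move=> mg mh.
rewrite (_ : (fun _ => _) = fun w => (g w && ~~ h w) || (~~ g w && h w)).
  by apply: measurable_or; apply: measurable_and => //; exact: measurable_neg.
by apply/funext => w; case: (g w); case: (h w).
Qed.

Lemma measurable_Xseq n : measurable_fun setT (fun w => Xseq (x ^~ w) n).
Proof.
elim: n => [|n IH] /=; first exact: measurable_cst.
apply: measurable_and; last exact: measurable_neg.
by apply: measurable_addb; exact: measurable_funPT.
Qed.

Lemma measurable_Mseq n s : measurable [set w | Mseq (x ^~ w) n = s].
Proof.
case: s => [[a b] c].
rewrite (_ : [set w | _] = (x n @^-1` [set a]) `&` (x n.-1 @^-1` [set b]) `&`
   ((fun w => Xseq (x ^~ w) n.-1) @^-1` [set c])); last first.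
  by apply/seteqP; split=> w /=; [case=> -> -> -> | case=> -[<- <-] <-].
apply: measurableI; first by apply: measurableI; exact: measurable_funPTI.
by rewrite -[X in measurable X]setTI; exact: measurable_Xseq.
Qed.

Context (p : R) (x_iid : iid_bernoulli p (fun j => x j.+1)).
Context (p_gt0 : 0 < p) (p_lt1 : p < 1).

Lemma iid_bernoulli_cylinder n (b : nat -> bool) :
  P [set w | forall i, (i < n)%N -> x i.+1 w = b i] =
  (\prod_(0 <= i < n) bern p (b i))%:E.
Proof.
case: x_iid => ind dist.
have := ind (iota 0 n) (fun i => [set b i]) (iota_uniq _ _) (fun _ => I).
rewrite (_ : \bigcap_(i in _) _ =
   [set w | forall i, (i < n)%N -> x i.+1 w = b i]); last first.
  by apply/seteqP; split=> w h i; have := h i; rewrite /= mem_iota.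
move=> ->; rewrite -[in LHS](subn0 n) -prodEFin; apply: eq_bigr => i _.
rewrite -[LHS]/(distribution P (x i.+1) [set b i]) dist.
rewrite bernoulli_probE ?(ltW p_gt0) ?(ltW p_lt1) // !diracE /bern.
have mem1 c : (c \in [set b i]) = (c == b i) by apply/idP/eqP; rewrite inE.
rewrite !mem1; case: (b i) => /=; rewrite mule1 mule0.
  by rewrite adde0.
by rewrite add0e.
Qed.

Lemma markov_chain_Mseq (x01 : forall w, x 0 w = x 1 w) :
  markov_chain P (fun j w => Mseq (x ^~ w) j.+1) (Mtrans p).
Proof.
split=> [n s||n s past]; first exact: measurable_Mseq.
  exact: stochastic_Mtrans.
move=> past_gt0.
(* An outcome [w0] in the past makes the states [s i] mutually consistent, so their first
   coordinates determine them and the past is a cylinder. *)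
have [w0 w0past] : past !=set0.
  by apply/set0P/eqP => past0; move: past_gt0; rewrite past0 measure0 ltxx.
have pastE : past = [set w | forall i, (i < n.+1)%N -> x i.+1 w = (s i).1.1].
  apply/seteqP; split=> w h i ilen; first by rewrite -h.
  rewrite -w0past //.
  have xE j : (j <= i.+1)%N -> x j w = x j w0.
    have xS k : (k <= i)%N -> x k.+1 w = x k.+1 w0.
      by move=> ki; rewrite h ?(leq_ltn_trans ki) // -w0past // (leq_trans ki).
    by case: j => [_|j]; [rewrite !x01; exact: xS | exact: xS].
  have XE j : (j <= i.+1)%N -> Xseq (x ^~ w) j = Xseq (x ^~ w0) j.
    by elim: j => //= j IH ji; rewrite IH ?(ltnW ji) // !xE // ltnW.
  by rewrite /Mseq !xE ?XE.
have PpastE := iid_bernoulli_cylinder n.+1 (fun i => (s i).1.1).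
rewrite -pastE in PpastE.
(* Either [s n.+1] follows [s n] under its own bit, and the cylinder gains one bit whose weight is
   the quotient, or the intersection with the past is empty. *)
rewrite /Mtrans; case: eqP => [sE|sN].
  rewrite /cond_prob (_ : _ `&` past =
      [set w | forall i, (i < n.+2)%N -> x i.+1 w = (s i).1.1]); last first.
    rewrite pastE; apply/seteqP; split=> [w [h1 h2] i|w h].
      rewrite ltnS leq_eqVlt => /orP[/eqP ->|]; last exact: h2.
      by rewrite -h1.
    have wpast : past w by rewrite pastE => i ilen; exact/h/ltnW.
    split; last by rewrite -pastE.
    by rewrite /= sE MseqS wpast // h.
  rewrite iid_bernoulli_cylinder PpastE big_nat_recr //= mulrC mulKf //.
  by rewrite gt_eqF // -lte_fin -PpastE.
rewrite /cond_prob (_ : _ `&` _ = set0) ?measure0 ?mul0r //.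
apply/seteqP; split=> // w [/= Mw pw]; apply: sN.
by rewrite -Mw MseqS -[in RHS](pw n).
Qed.

End Bits.

Theorem theorem2 (R : realType) (d : measure_display) (T : measurableType d)
    (P : probability T R) (p : R) (p_gt0 : 0 < p) (p_lt1 : p < 1)
    (x : nat -> {RV P >-> bool})
    (x_iid : iid_bernoulli p (fun j => x j.+1))
    (x0 : forall w, x 0%N w = x 1%N w) :
  (exists Q : bool * bool * bool -> bool * bool * bool -> R,
     [/\ markov_chain P (fun j w => Mseq (x ^~ w) j.+1) Q,
         irreducible Q & aperiodic Q]) /\
  (forall (n : nat) (w : T), (1 <= n)%N ->
     HS (butterfly [seq x j w | j <- iota 1 n]) =
       (\sum_(1 <= j < n.+1) Xseq (x ^~ w) j)%N /\
     (\sum_(1 <= j < n.+1) Xseq (x ^~ w) j)%N =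
       (\sum_(1 <= j < n.+1) f (Mseq (x ^~ w) j))%N).
Proof.
split; last first.
  move=> n w _; split; last by rewrite !big_add1; exact: eq_bigr.
  by case: (@butterfly_hit_state (x ^~ w) n (x0 w)).
exists (Mtrans p); split.
- exact: markov_chain_Mseq.
- exact: irreducible_Mtrans.
- exact: aperiodic_Mtrans.
Qed.
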